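(* Let $r$ be a relation with dimension set $\mathcal{D}$. The set of tuples over $\mathcal{D}$ (i.e. disregarding measure values) constituting the data cube of $r$ is a convex cube for the constraint ''$\mathrm{COUNT}( * )\geq 1$'': $$Datacube(r) = \{t\in CL(r)\mid t[\mathrm{COUNT}( * )]\geq 1\}.$$
   Context: A relation $r$ is a finite nonempty collection of tuples over a finite nonempty set $\mathcal{D}$ of dimension attributes and a set of measure attributes. For $A\in\mathcal{D}$, $Dim(A)$ is the set of values of $A$ occurring in $r$; $\mathrm{ALL}$ is a new symbol not in any $Dim(A)$. The multidimensional space is $$Space(r) = \Big(\prod_{A\in\mathcal{D}} (Dim(A)\cup\{\mathrm{ALL}\})\Big)\cup\{(\emptyset,\dots,\emptyset)\},$$ where $(\emptyset,\dots,\emptyset)$ is an additional element. The generalization order on $Space(r)$ is: $u\preceq_g v$ iff either $v=(\emptyset,\dots,\emptyset)$, or $u,v\neq(\emptyset,\dots,\emptyset)$ and $u[A]=v[A]$ for all $A\in\mathcal{D}$ with $u[A]\neq\mathrm{ALL}$. The cube lattice is $CL(r)=\langle Space(r),\preceq_g\rangle$. Tuples of $r$, projected on $\mathcal{D}$, are regarded as elements of $CL(r)$. $t[\mathrm{COUNT}( * )]$ is the number of tuples $t'$ of $r$ with $t\preceq_g t'$. Data cube: for $X\subseteq\mathcal{D}$, the cuboid of $r$ along $X$ (the result of a GROUP BY on $X$) consists of the tuples $t$ for which there is $t'\in r$ with $t[A]=t'[A]$ for $A\in X$ and $t[A]=\mathrm{ALL}$ for $A\in\mathcal{D}\setminus X$.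 $Datacube(r)$ is the union of the cuboids over all $X\subseteq\mathcal{D}$. A constraint (predicate) $Const$ on $CL(r)$ is monotone if $t\preceq_g u$ and $Const(t)$ imply $Const(u)$, and antimonotone if $t\preceq_g u$ and $Const(u)$ imply $Const(t)$. A convex cube for a constraint $const$ is a set of the form $\{t\in CL(r)\mid const(t)\}$, where $const$ is a conjunction of monotone and/or antimonotone constraints; such a set $\mathcal{C}$ is order-convex: $x\preceq_g y\preceq_g z$ and $x,z\in\mathcal{C}$ imply $y\in\mathcal{C}$. *)

(* Defs.v *)
From HB Require Import structures.
From mathcomp Require Import all_boot all_order.
From mathcomp Require Import classical_sets.

Set Implicit Arguments.
Unset Strict Implicit.
Unset Printing Implicit Defensive.

Import Order.TTheory.

Local Open Scope classical_set_scope.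
Local Open Scope order_scope.

Section CubeLattice.

(* [V A] is the domain of values of the dimension attribute [A], and [W m] that
   of the measure attribute [m]; there may be no measure attribute. *)
Variables (D : finType) (V : D -> choiceType).
Variables (M : finType) (W : M -> choiceType).

Definition dims := {dffun forall A : D, V A}.
Definition measures := {dffun forall m : M, W m}.

(* A finite collection of tuples, possibly with repetitions; a set of tuples is
   the case of a duplicate-free sequence. *)
Definition relation := seq (dims * measures).

Definition Dim (r : relation) (A : D) : seq (V A) := [seq t.1 A | t : dims * measures <- r].

Definition ALL (A : D) : option (V A) := None.

Definition gtuple := {dffun forall A : D, option (V A)}.

(* Ambient type of the multidimensional spaces of all relations over [D];
   [None] is the additional element (emptyset, ..., emptyset). *)
Definition cell : Type := option gtuple.
HB.instance Definition _ := Choice.on cell.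

Definition empty_cell : cell := None.

Definition Space (r : relation) : set cell :=
  [set t | t = empty_cell \/
     exists2 u : gtuple, t = Some u &
       forall A : D, u A = ALL A \/ exists2 x : V A, x \in Dim r A & u A = Some x].

Definition gen_le (t u : cell) : bool :=
  match t, u with
  | _, None => true
  | None, Some _ => false
  | Some a, Some b => [forall A : D, (a A != ALL A) ==> (a A == b A)]
  end.

Lemma gen_le_refl : reflexive gen_le.
Proof. by case=> [a|] //=; apply/forallP => A; rewrite eqxx implybT. Qed.

Lemma gen_le_anti : antisymmetric gen_le.
Proof.
case=> [a|] [b|] //= /andP[/forallP ab /forallP ba].
congr Some; apply/ffunP => A.
move: (ab A) (ba A); case: eqP => [-> _|_ /eqP //].
by case: eqP => [-> //|_ /eqP].
Qed.

Lemma gen_le_trans : transitive gen_le.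
Proof.
case=> [b|] [a|] [c|] //= /forallP ab /forallP bc; apply/forallP => A.
apply/implyP => aA; have /eqP e := implyP (ab A) aA.
by have := bc A; rewrite -e aA.
Qed.

Fact gen_display : Order.disp_t. Proof. exact: Order.Disp tt tt. Qed.

(* From here on, [t <= u] on cells is the generalization order. *)
HB.instance Definition _ := Order.Le_isPOrder.Build gen_display cell
  gen_le_refl gen_le_anti gen_le_trans.

(* The carrier of the cube lattice, ordered by the order of [cell]. *)
Definition CL (r : relation) : set cell := Space r.

Definition cell_of (d : dims) : cell :=
  Some ([ffun A : D => Some (d A)] : gtuple).

Definition COUNT (r : relation) (t : cell) : nat :=
  count (fun t' : dims * measures => t <= cell_of t'.1) r.

Definition cuboid (r : relation) (X : {set D}) : set cell :=
  [set t | exists u : gtuple, t = Some u /\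
     exists2 t' : dims * measures, t' \in r &
       forall A : D, (A \in X -> u A = Some (t'.1 A)) /\
                     (A \notin X -> u A = ALL A)].

Definition Datacube (r : relation) : set cell :=
  \bigcup_(X : {set D}) cuboid r X.

(* A constraint on [CL r] is a predicate on cells of which only the values on
   [CL r] matter. *)
Definition monotone (r : relation) (c : cell -> Prop) : Prop :=
  forall t u : cell, CL r t -> CL r u -> t <= u -> c t -> c u.

Definition antimonotone (r : relation) (c : cell -> Prop) : Prop :=
  forall t u : cell, CL r t -> CL r u -> t <= u -> c u -> c t.

Definition conj_monotone_antimonotone (r : relation) (const : cell -> Prop) :
    Prop :=
  exists (n : nat) (c : 'I_n -> cell -> Prop),
    (forall i : 'I_n, monotone r (c i) \/ antimonotone r (c i)) /\
    (forall t : cell, CL r t -> (const t <-> forall i : 'I_n, c i t)).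

Definition convex_cube_for (r : relation) (const : cell -> Prop)
    (C : set cell) : Prop :=
  conj_monotone_antimonotone r const /\ C = [set t | CL r t /\ const t].

End CubeLattice.

(* Main.v *)
Require Import Defs.
From mathcomp Require Import all_boot all_order.
From mathcomp Require Import classical_sets.

Local Open Scope classical_set_scope.

(** A nonempty cell generalizes a tuple [t'] of [r] exactly when it arises from [t'] by replacing
    some coordinates by [ALL], that is, when it is a row of the cuboid along its non-[ALL]
    attributes. So lying in some cuboid amounts to generalizing at least one tuple, which is
    [1 <= COUNT] ([Datacube_COUNT]). By transitivity of the order, [COUNT] can only drop on passing
    to a more specific cell ([COUNT_antimono]), so this constraint is antimonotone and the cube is
    convex. *)

Lemma COUNT_antimono (D : finType) (V : D -> choiceType) (M : finType)
    (W : M -> choiceType) (r : relation V W) (t u : cell V) :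
  (t <= u)%O -> COUNT r u <= COUNT r t.
Proof. by move=> tu; apply: sub_count => t'; apply: Order.POrderTheory.le_trans. Qed.

Lemma le_cell_of (D : finType) (V : D -> choiceType) (u : gtuple V)
    (d : dims V) :
  reflect (forall A : D, u A != ALL V A -> u A = Some (d A))
          ((Some u : cell V) <= cell_of d)%O.
Proof.
apply: (iffP forallP) => le_ud A; have := le_ud A.
- by rewrite ffunE => /implyP le_A /le_A /eqP.
- by rewrite ffunE => le_A; apply/implyP => /le_A /eqP.
Qed.

Lemma Datacube_COUNT (D : finType) (V : D -> choiceType) (M : finType)
    (W : M -> choiceType) (r : relation V W) :
  Datacube r = [set t : cell V | CL r t /\ 1 <= COUNT r t].
Proof.
apply/seteqP; split => t /=.
- case=> X _ [u [-> [t' t'r ut']]]; split.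
  (* The values of [u] off [ALL] are copied from [t'], hence occur in [r]. *)
  + right; exists u => // A; have [uX uNX] := ut' A.
    have [/uX uA|/uNX ?] := boolP (A \in X); last by left.
    by right; exists (t'.1 A) => //; apply: (map_f (fun s : dims V * measures W => s.1 A)).
  + rewrite /COUNT -has_count; apply/hasP; exists t' => //.
    apply/le_cell_of => A; have [uX uNX] := ut' A.
    by have [/uX|/uNX ->] := boolP (A \in X); rewrite ?eqxx.
- case=> _; rewrite /COUNT -has_count => /hasP[t' t'r].
  (* The empty cell is the top of the order and lies below no tuple, so it cannot have a positive
     count. *)
  case: t => [u /le_cell_of ut'|//].
  (* The grouping set can be read off [u] itself, whichever tuple [t'] witnesses the count. *)
  exists [set A | u A != ALL V A]%SET => //.
  exists u; split=> //; exists t' => // A; rewrite inE; split; first exact: ut'.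
  by move/negPn/eqP.
Qed.

Theorem proposition4p1 (D : finType) (V : D -> choiceType)
    (M : finType) (W : M -> choiceType) (r : relation V W)
    (hD : 0 < #|D|) (hr : 0 < size r) :
  convex_cube_for r (fun t : cell V => 1 <= COUNT r t) (Datacube r) /\
  Datacube r = [set t : cell V | CL r t /\ 1 <= COUNT r t].
Proof.
split; last exact: Datacube_COUNT.
split; last exact: Datacube_COUNT.
(* The constraint is a conjunction with a single, antimonotone, conjunct. *)
exists 1, (fun _ t => 1 <= COUNT r t); split=> [_|t _].
- by right=> t u _ _ /(@COUNT_antimono _ _ _ _ r) le_ut /leq_trans; apply.
- by split=> [//|]; apply; exact: ord0.
Qed.
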